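(* Let $P$ and $Q$ be finite ordered sets where $\mathrm{h}(P)\le 1$. If $P^P\cong Q^Q$, then $P\cong Q$.
   Context: An ordered set is a non-empty partially ordered set. For ordered sets $X,Y$, $Y^X$ denotes the ordered set of order-preserving maps $X\to Y$, ordered pointwise: $f\le g$ iff $f(x)\le g(x)$ for all $x\in X$. The symbol $\cong$ denotes order-isomorphism. The height $\mathrm{h}(P)$ of a finite ordered set $P$ is the size of the largest chain in $P$ minus one. *)

(* Defs.v *)
From HB Require Import structures.
From mathcomp Require Import all_boot all_order.

Set Implicit Arguments.
Unset Strict Implicit.
Unset Printing Implicit Defensive.

Import Order.Theory.
Local Open Scope order_scope.

Section OrderPreservingMaps.
Context {dX dY : Order.disp_t} (X : finPOrderType dX) (Y : finPOrderType dY).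

Definition order_preserving (f : {ffun X -> Y}) : bool :=
  [forall x, forall y, (x <= y) ==> (f x <= f y)].

(* The order exponential Y^X. Finite functions are used instead of
   {omorphism X -> Y} so that equality of maps is extensional and Y^X is
   itself a finite partial order. *)
Record opmap : predArgType :=
  OMap { opmap_val :> {ffun X -> Y}; _ : order_preserving opmap_val }.

HB.instance Definition _ := [isSub for opmap_val].
HB.instance Definition _ := [Finite of opmap by <:].

Definition opmap_le (f g : opmap) : bool := [forall x, f x <= g x].

Fact opmap_le_refl : reflexive opmap_le.
Proof. by move=> f; apply/forallP. Qed.

Fact opmap_le_anti : antisymmetric opmap_le.
Proof.
move=> f g /andP[/forallP lefg /forallP legf]; apply/val_inj/ffunP => x.
by apply: le_anti; rewrite lefg legf.
Qed.

Fact opmap_le_trans : transitive opmap_le.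
Proof.
move=> g f h /forallP lefg /forallP legh; apply/forallP => x.
exact: le_trans (lefg x) (legh x).
Qed.

Fact opmap_display : Order.disp_t. Proof. exact: Order.Disp tt tt. Qed.

HB.instance Definition _ := Order.Le_isPOrder.Build opmap_display opmap
  opmap_le_refl opmap_le_anti opmap_le_trans.

End OrderPreservingMaps.

Definition order_isomorphic {d d' : Order.disp_t}
    (X : porderType d) (Y : porderType d') : Prop :=
  exists2 f : X -> Y, bijective f & {mono f : x y / x <= y}.

Definition chain {d : Order.disp_t} (X : finPOrderType d) (A : {set X}) : bool :=
  [forall x in A, forall y in A, x >=< y].

(* The truncated predecessor is harmless: a non-empty X has a chain of size 1. *)
Definition height {d : Order.disp_t} (X : finPOrderType d) : nat :=
  (\max_(A : {set X} | chain A) #|A|)%N.-1.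

(* Main.v *)
(* Chains of Y^X have length at most |X| h(Y), because the sum of the ranks of
   the values increases strictly, and a maximal chain of Y yields a chain of
   constants in Y^X that refines to one of exactly this length.  So
   |P| h(P) = |Q| h(Q), which leaves the case h(P) = 1 once antichains have been
   counted.  Let c0 < c1 < ... < e be a maximal chain of Q and [F, G] the interval
   of Q^Q between the constants c0 and e.  Its longest chains are as long as those
   of Q^Q, so the corresponding [f, g] in P^P has f minimal and g maximal at
   every point, whence its join-irreducibles are indexed by P, reversed: p gives
   the map equal to g above p and to f elsewhere.  In [F, G], the maps equal to
   the atom c1 above q and to c0 elsewhere are join-irreducible, so Q embeds in P.
   Then h(Q) <= 1, hence |P| = |Q| and the embedding is an isomorphism. *)
Require Import Defs.
From mathcomp Require Import all_boot all_order.

Set Implicit Arguments.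
Unset Strict Implicit.
Unset Printing Implicit Defensive.

Import Order.Theory.
Local Open Scope order_scope.

(** * Ranks and longest chains in a finite ordered set *)

Section Rank.
Context {d : Order.disp_t} (X : finPOrderType d).
Implicit Types (x y : X) (A : {set X}).

(** The height of the element [x], that is, the number of steps in a longest chain with top [x];
    minimal elements have rank 0. *)
Definition rank x : nat :=
  \max_(A : {set X} | chain A && [forall y in A, y < x]) #|A|.

Lemma chainP A :
  reflect {in A &, forall x y, x >=< y} (chain A).
Proof.
apply: (iffP forall_inP) => [cA x y xA yA|cA x xA].
  by have /forall_inP := cA x xA; apply.
by apply/forall_inP => y yA; apply: cA.
Qed.

Lemma chain_add_top x A :
  chain A -> {in A, forall y, y < x} -> chain (x |: A) /\ #|x |: A| = #|A|.+1.
Proof.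
move=> /chainP cA ltA; split; last first.
  by rewrite cardsU1; case: (boolP (x \in A)) => // /ltA; rewrite ltxx.
apply/chainP => y z; rewrite !inE => /predU1P[->|yA] /predU1P[->|zA].
- exact: comparablexx.
- by rewrite comparable_sym; apply/lt_comparable/ltA.
- exact/lt_comparable/ltA.
- exact: cA.
Qed.

Lemma rank_witness x :
  exists A, [/\ chain A, {in A, forall y, y < x} & #|A| = rank x].
Proof.
have chain0 : chain (set0 : {set X}) && [forall y in (set0 : {set X}), y < x].
  by apply/andP; split; [apply/chainP => y z|apply/forall_inP => y]; rewrite inE.
rewrite /rank (bigop.bigmax_eq_arg set0) //.
case: arg_maxnP => //= A /andP[cA /forall_inP ltA] _.
by exists A.
Qed.

Lemma rank_lt x y : x < y -> (rank x < rank y)%N.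
Proof.
move=> ltxy; have [A [cA ltA <-]] := rank_witness x.
have [cxA <-] := chain_add_top cA ltA.
apply: (leq_bigmax_cond (x |: A)); rewrite cxA; apply/forall_inP => z.
by rewrite !inE => /predU1P[->//|/ltA/lt_trans]; apply.
Qed.

Lemma chain_card_height A : chain A -> (#|A| <= (height X).+1)%N.
Proof. by move=> cA; apply: leq_trans (leqSpred _); apply: leq_bigmax_cond. Qed.

Lemma rank_height x : (rank x <= height X)%N.
Proof.
have [A [cA ltA <-]] := rank_witness x.
have [cxA card_xA] := chain_add_top cA ltA.
by rewrite -ltnS -card_xA chain_card_height.
Qed.

Lemma rank_path x s : path <%O x s -> (rank x + size s <= rank (last x s))%N.
Proof.
elim: s x => [|y s IHs] x /=; first by rewrite addn0.
case/andP=> /rank_lt ltxy /IHs; apply: leq_trans.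
by rewrite addnS -addSn leq_add2r.
Qed.

Lemma path_le_last x s : path <%O x s -> x <= last x s.
Proof.
by elim: s x => //= y s IHs x /andP[/ltW lexy /IHs]; apply: le_trans.
Qed.

(** A longest chain, sorted, is a strict path; its first element is split off as the start, so the
    number of steps is the height. *)
Lemma height_path : (0 < #|X|)%N ->
  exists x s, path (<%O : rel X) x s /\ size s = height X.
Proof.
move=> /card_gt0P[x0 _].
have chain1 : chain [set x0].
  by apply/chainP => x y; rewrite !inE => /eqP-> /eqP->; apply: comparablexx.
have [A cA maxA] : exists2 A : {set X}, chain A & #|A| = (height X).+1.
  rewrite /height (bigop.bigmax_eq_arg [set x0]) //.
  case: arg_maxnP => //= A cA /(_ _ chain1); rewrite cards1 => Agt0.
  by exists A => //; rewrite prednK.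
pose s := sort <=%O (enum A).
have: sorted <%O s.
  rewrite lt_sorted_uniq_le sort_uniq enum_uniq /=.
  apply: (@sort_sorted_in _ (mem A)); first by move/chainP: cA.
  by apply/allP => x; rewrite mem_enum.
have: size s = (height X).+1 by rewrite size_sort -cardE.
by case: s => //= x s [size_s] lt_s; exists x, s.
Qed.

End Rank.

Lemma height_embedding d d' (X : finPOrderType d) (Y : finPOrderType d')
    (f : X -> Y) :
  {mono f : x y / x <= y} -> (height X <= height Y)%N.
Proof.
move=> fM; have f_inj := inc_inj fM.
rewrite /height -!subn1 leq_sub2r //; apply/bigmax_leqP => A /chainP cA.
rewrite -(card_imset _ f_inj).
apply: (leq_bigmax_cond (f @: A)); apply/chainP => _ _ /imsetP[x xA ->] /imsetP[y yA ->].
by rewrite /Order.comparable !fM; apply: cA.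
Qed.

(** * Order-preserving maps and their splicing along up-sets *)

Section Opmap.
Context {dX dY : Order.disp_t} (X : finPOrderType dX) (Y : finPOrderType dY).
Implicit Types (f g h : opmap X Y) (U : {set X}) (x y : X).

Lemma opmap_leP f g : reflect (forall x, f x <= g x) (f <= g).
Proof. exact: forallP. Qed.

Lemma opmapP f g : (forall x, f x = g x) -> f = g.
Proof. by move=> eqfg; apply/val_inj/ffunP. Qed.

Lemma opmap_homo f : {homo f : x y / x <= y}.
Proof. by case: f => f /= /forallP homf x y; move/forallP/(_ y)/implyP: (homf x). Qed.

Lemma opmap_of_subproof (f : X -> Y) :
  {homo f : x y / x <= y} -> order_preserving [ffun x => f x].
Proof. by move=> fH; apply/'forall_forallP => x y; rewrite !ffunE; apply/implyP/fH. Qed.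

Definition opmap_of (f : X -> Y) (fH : {homo f : x y / x <= y}) : opmap X Y :=
  OMap (opmap_of_subproof fH).

Lemma opmap_ofE f fH x : @opmap_of f fH x = f x.
Proof. by rewrite ffunE. Qed.

Definition opconst (c : Y) : opmap X Y :=
  opmap_of (fun _ _ _ => lexx c).

Lemma opconstE (c : Y) x : opconst c x = c.
Proof. by rewrite /= ffunE. Qed.

Definition upset U := forall x y, x <= y -> x \in U -> y \in U.

(** Moving up never leaves [U], so the only possible switch is from [f] to the larger [g]. *)
Lemma splice_homo f g U (le_fg : f <= g) (upU : upset U) :
  {homo (fun x => if x \in U then g x else f x) : x y / x <= y}.
Proof.
move=> x y lexy; case: ifP => [/(upU _ _ lexy)->|_]; first exact: opmap_homo.
have le_fxy := opmap_homo f lexy; case: ifP => // _.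
exact: le_trans le_fxy (opmap_leP _ _ le_fg y).
Qed.

Definition splice f g U (le_fg : f <= g) (upU : upset U) : opmap X Y :=
  opmap_of (splice_homo le_fg upU).

Lemma spliceE f g U le_fg upU x :
  @splice f g U le_fg upU x = if x \in U then g x else f x.
Proof. by rewrite /= ffunE. Qed.

Lemma upset_ge x : upset [set y | x <= y].
Proof. by move=> y z leyz; rewrite !inE => /le_trans; apply. Qed.

Lemma upset_gt x : upset [set y | x < y].
Proof. by move=> y z leyz; rewrite !inE => /lt_le_trans; apply. Qed.

(* Adding to [U] a maximal point of its complement moves one value up at a
   time, so the path visits one map per point outside [U]. *)
Lemma splice_path f g (le_fg : f <= g) (lt_fg : forall x, f x < g x) U h :
  upset U -> (forall x, h x = if x \in U then g x else f x) ->
  exists s, [/\ path <%O h s, last h s = g & size s = #|~: U|].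
Proof.
move En: #|~: U| => n; elim: n U h En => [|n IHn] U h cardU upU hE.
  exists [::]; split=> //=; apply: opmapP => x; rewrite hE.
  by move/eqP: cardU; rewrite cards_eq0 => /eqP/setP/(_ x); rewrite !inE => /negbFE->.
have /card_gt0P[x0 x0U] : (0 < #|~: U|)%N by rewrite cardU.
(* Rank is strictly increasing, so a point of largest rank outside [U] is maximal there. *)
have [x xU maxx] := @arg_maxnP _ x0 (mem (~: U)) (@rank _ X) x0U.
have {}xU : x \notin U by move: xU; rewrite /= inE.
have upxU : upset (x |: U).
  move=> y z leyz; rewrite !inE => /orP[/eqP eyx|/(upU _ _ leyz)->]; last by rewrite orbT.
  case: eqVneq => //= neqzx; apply/negPn/negP => zU.
  have ltxz : x < z by rewrite lt_neqAle eq_sym neqzx -eyx.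
  have := maxx z; rewrite /= inE => /(_ zU); apply/negP.
  by rewrite -ltnNge rank_lt.
have [|y|s [path_s last_s size_s]] := IHn (x |: U) (splice le_fg upxU) _ upxU.
- by apply/eqP; rewrite -eqSS -cardU [in X in _ == X](cardsD1 x) !inE xU /=
    setDE setCU setIC.
- by rewrite spliceE.
exists (splice le_fg upxU :: s); split=> //=; last by rewrite size_s.
rewrite path_s andbT lt_neqAle; apply/andP; split.
  apply/eqP => /(congr1 (fun k : opmap X Y => k x)).
  rewrite spliceE hE !inE eqxx (negPf xU) /= => eqfg.
  by have := lt_fg x; rewrite eqfg ltxx.
apply/opmap_leP => y; rewrite spliceE hE !inE.
case: (y \in U); first by rewrite orbT.
by rewrite orbF; case: ifP => // _; apply: ltW.
Qed.

(** * Longest chains of [opmap X Y] *)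

(** Each step between two constants is refined by raising the points of [X] one by one, starting
    from the empty up-set. *)
Lemma opconst_path (c : Y) s : path <%O c s ->
  exists t, [/\ path <%O (opconst c) t, last (opconst c) t = opconst (last c s)
              & size t = (#|X| * size s)%N].
Proof.
elim: s c => [|c' s IHs] c /=; first by exists [::]; rewrite muln0.
case/andP=> ltcc' /IHs[t [path_t last_t size_t]].
have ltc x : opconst c x < opconst c' x by rewrite ?(opconstE, spliceE).
have lec : opconst c <= opconst c' by apply/opmap_leP => x; apply/ltW/ltc.
have up0 : upset set0 by move=> x y _; rewrite inE.
have [|u [path_u last_u size_u]] := splice_path (h := opconst c) lec ltc up0.
  by move=> x; rewrite inE.
exists (u ++ t); rewrite cat_path last_cat last_u path_u size_cat size_t size_u.
by rewrite setC0 cardsT mulnS.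
Qed.

Lemma rank_sum_lt f g : f < g -> (\sum_x rank (f x) < \sum_x rank (g x))%N.
Proof.
rewrite lt_neqAle => /andP[neq_fg /opmap_leP le_fg].
have le_rank x : (rank (f x) <= rank (g x))%N.
  by move: (le_fg x); rewrite le_eqVlt => /predU1P[->//|/rank_lt/ltnW].
have [x neqx] : exists x, f x != g x.
  apply/existsP; rewrite -negb_forall; apply: contra neq_fg => /forallP eqfg.
  by apply/eqP/opmapP => x; apply/eqP.
rewrite (bigD1 x) //= [X in (_ < X)%N](bigD1 x) //= -addSn leq_add //.
  by rewrite rank_lt // lt_neqAle neqx le_fg.
exact: leq_sum.
Qed.

Lemma rank_sum_path f s : path <%O f s ->
  (\sum_x rank (f x) + size s <= \sum_x rank (last f s x))%N.
Proof.
elim: s f => [|g s IHs] f /=; first by rewrite addn0.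
case/andP=> /rank_sum_lt lt_fg /IHs; apply: leq_trans.
by rewrite addnS -addSn leq_add2r.
Qed.

Lemma rank_sum_height f : (\sum_x rank (f x) <= #|X| * height Y)%N.
Proof. by rewrite -sum_nat_const; apply: leq_sum => x _; apply: rank_height. Qed.

Lemma opmap_path_size f s : path <%O f s -> (size s <= #|X| * height Y)%N.
Proof.
move=> /rank_sum_path le_s; apply: leq_trans (rank_sum_height (last f s)).
exact: leq_trans (leq_addl _ _) le_s.
Qed.

(** The sum of ranks starts at 0 or more, gains at least 1 per step and is bounded by
    [#|X| * height Y]. A path of that length leaves no slack, so every term is extreme at both
    ends. *)
Lemma maximal_path_rank f s x : path <%O f s -> size s = (#|X| * height Y)%N ->
  rank (f x) = 0%N /\ rank (last f s x) = height Y.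
Proof.
move=> /rank_sum_path le_s size_s; move: le_s; rewrite {}size_s => le_s.
have le_last := rank_sum_height (last f s); split.
  have: \sum_x rank (f x) == 0%N.
    by rewrite -leqn0 -(leq_add2r (#|X| * height Y)) (leq_trans le_s).
  by rewrite sum_nat_eq0 => /forall_inP/(_ x isT)/eqP.
apply/eqP; rewrite eqn_leq rank_height leqNgt; apply/negP => lt_x.
have: (\sum_x rank (last f s x) < #|X| * height Y)%N.
  rewrite -sum_nat_const (bigD1 x) //= [X in (_ < X)%N](bigD1 x) //= -addSn leq_add //.
  by apply: leq_sum => y _; apply: rank_height.
by rewrite ltnNge (leq_trans (leq_addl _ _) le_s).
Qed.

(** * Irreducible maps in an interval *)

(* Join-irreducibility of [j] in the interval from [f] to [g], where [m] is its
   unique lower cover; no lattice structure is assumed. *)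
Definition irreducible_over f g j m :=
  [/\ f <= m, m < j, j <= g & forall h, f <= h -> h < j -> h <= m].

(** A map [h] strictly below the first splice cannot take the value [c'] at [x], since by
    monotonicity it would then dominate that splice. Hence [h x = c], which places [h] below the
    second splice. *)
Lemma atom_irreducible (c c' e : Y) (le_c : opconst c <= opconst c') x :
  c < c' -> c' <= e -> (forall b, c <= b -> b < c' -> b = c) ->
  irreducible_over (opconst c) (opconst e)
    (splice le_c (@upset_ge x)) (splice le_c (@upset_gt x)).
Proof.
move=> ltcc' lec'e atom; have lecc' := ltW ltcc'; split.
- by apply/opmap_leP => y; rewrite ?(opconstE, spliceE); case: ifP.
- rewrite lt_neqAle; apply/andP; split.
    apply/eqP => /(congr1 (fun k : opmap X Y => k x)).
    by rewrite ?(opconstE, spliceE) !inE ltxx lexx => eqc; rewrite eqc ltxx in ltcc'.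
  apply/opmap_leP => y; rewrite ?(opconstE, spliceE) !inE.
  by case: ifP => [/ltW->//|_]; case: ifP.
- apply/opmap_leP => y; rewrite ?(opconstE, spliceE); case: ifP => // _.
  exact: le_trans lec'e.
move=> h /opmap_leP lech lthj; have /opmap_leP lehj := ltW lthj.
have hx : h x = c.
  apply: atom; first by have := lech x; rewrite ?(opconstE, spliceE).
  have := lehj x; rewrite ?(opconstE, spliceE) inE lexx le_eqVlt => /predU1P[hx|//].
  have /lt_geF/negP[] := lthj.
  apply/opmap_leP => y; rewrite ?(opconstE, spliceE) inE; case: ifP => [lexy|_].
    by rewrite -hx; apply: opmap_homo.
  by have := lech y; rewrite ?(opconstE, spliceE).
apply/opmap_leP => y; have := lehj y; rewrite !spliceE !inE !opconstE lt_neqAle.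
by case: eqVneq => [<- _|_] //; rewrite hx.
Qed.

(** Where [m] and [j] differ, at [x] say, covering forces [m x = f x] and [j x = g x]. As [g] is
    constant above [x], the splice at [x] lies below [j]; if it were not [j], it would lie below
    [m], contradicting [m x = f x]. *)
Lemma irreducible_splice f g (le_fg : f <= g) :
  (forall x y, x <= y -> g x = g y) ->
  (forall x b b', f x <= b -> b < b' -> b' <= g x -> b = f x /\ b' = g x) ->
  (forall x, f x < g x) ->
  forall j m, irreducible_over f g j m ->
  exists x, j = splice le_fg (@upset_ge x).
Proof.
move=> g_const cover lt_fg j m [/opmap_leP le_fm lt_mj /opmap_leP le_jg max_m].
have /opmap_leP le_mj := ltW lt_mj.
have [x neqx] : exists x, m x != j x.
  apply/existsP; rewrite -negb_forall; apply: contraTN lt_mj => /forallP eqmj.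
  by rewrite (_ : m = j) ?ltxx //; apply: opmapP => x; apply/eqP.
have ltx : m x < j x by rewrite lt_neqAle neqx le_mj.
have [mx jx] := cover x _ _ (le_fm x) ltx (le_jg x).
exists x; apply/eqP; rewrite eq_sym; apply/negPn/negP => neqj.
have le_sj : splice le_fg (@upset_ge x) <= j.
  apply/opmap_leP => y; rewrite spliceE inE; case: ifP => [lexy|_].
    by rewrite -(g_const _ _ lexy) -jx; apply: opmap_homo.
  exact: le_trans (le_fm y) (le_mj y).
have /opmap_leP/(_ x) : splice le_fg (@upset_ge x) <= m.
  apply: max_m; last by rewrite lt_neqAle neqj.
  apply/opmap_leP => y; rewrite spliceE; case: ifP => // _; exact: ltW.
by rewrite spliceE inE lexx mx (lt_geF (lt_fg x)).
Qed.

Lemma splice_ge_mono f g (le_fg : f <= g) : (forall x, f x < g x) ->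
  {mono (fun x => splice le_fg (@upset_ge x)) : x y /~ x <= y}.
Proof.
move=> lt_fg x y; apply/opmap_leP/idP => [/(_ x)|leyx z].
  rewrite ?(opconstE, spliceE) !inE lexx; case: ifP => // _ /le_lt_trans/(_ (lt_fg x)).
  by rewrite ltxx.
rewrite ?(opconstE, spliceE) !inE; case: (boolP (x <= z)) => [/(le_trans leyx)->//|_].
by case: ifP => // _; apply: ltW.
Qed.

End Opmap.

(** * Transport along isomorphisms of exponentials *)

Lemma order_isomorphic_sym d d' (X : porderType d) (Y : porderType d') :
  order_isomorphic X Y -> order_isomorphic Y X.
Proof.
case=> f [g fK gK] fM; exists g; first by exists f.
by move=> x y; rewrite -fM !gK.
Qed.

Lemma iso_opmap_height_le dX dY dX' dY'
    (X : finPOrderType dX) (Y : finPOrderType dY)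
    (X' : finPOrderType dX') (Y' : finPOrderType dY') :
  (0 < #|Y'|)%N -> order_isomorphic (opmap X' Y') (opmap X Y) ->
  (#|X'| * height Y' <= #|X| * height Y)%N.
Proof.
move=> /height_path[c [s [path_s <-]]] [f _ fM].
have [t [path_t _ <-]] := opconst_path X' path_s.
rewrite -(size_map f); apply: (@opmap_path_size _ _ _ _ (f (opconst X' c))).
by rewrite (mono_path (leW_mono fM)).
Qed.

Lemma iso_opmap_embedding dX dY dX' dY'
    (X : finPOrderType dX) (Y : finPOrderType dY)
    (X' : finPOrderType dX') (Y' : finPOrderType dY') :
  order_isomorphic (opmap X' Y') (opmap X Y) ->
  (0 < #|X'|)%N -> (0 < #|Y'|)%N -> (0 < height Y')%N -> (height Y <= 1)%N ->
  (#|X'| * height Y' = #|X| * height Y)%N ->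
  exists e : X' -> X, {mono e : x y / x <= y}.
Proof.
move=> [phi phi_bij phiM] X'_gt0 Y'_gt0 hY' hY eqh.
have [psi phiK psiK] := phi_bij.
have phi_lt := leW_mono phiM.
have [c [[|c' s] [path_cs size_s]]] := height_path Y'_gt0.
  by rewrite -size_s in hY'.
set e := last c (c' :: s).
have [t [path_t last_t size_t]] := opconst_path X' path_cs.
have {size_t} size_t : size t = (#|X| * height Y)%N by rewrite size_t size_s.
have := path_cs; move=> /= /andP[ltcc' path_s].
have lec'e : c' <= e := path_le_last path_s.
(* All but one of the [height Y'] steps of the path lie above [c']. Hence [c'] covers [c]. *)
have rank_c' : (rank c' <= 1)%N.
  have := leq_trans (rank_path path_s) (rank_height _).
  by rewrite -size_s /= -[X in (_ <= X)%N]add1n leq_add2r.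
have atom b : c <= b -> b < c' -> b = c.
  rewrite le_eqVlt => /predU1P[->//|/rank_lt ltcb] /rank_lt ltbc'.
  by move: (leq_trans ltbc' rank_c'); rewrite ltnS leqn0 => /eqP b0; rewrite b0 in ltcb.
have lec : opconst X' c <= opconst X' c'.
  by apply/opmap_leP => x; rewrite !opconstE ltW.
pose f := phi (opconst X' c); pose g := phi (opconst X' e).
have path_f : path <%O f (map phi t) by rewrite (mono_path phi_lt).
have last_f : last f (map phi t) = g by rewrite last_map last_t.
(* The transported path has the greatest possible length, so its ends have extreme rank at every
   point. *)
have rank_fg x := maximal_path_rank x path_f (etrans (size_map _ _) size_t).
have rank_f x : rank (f x) = 0%N by have [] := rank_fg x.
have rank_g x : rank (g x) = height Y by have [_] := rank_fg x; rewrite last_f.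
have hY1 : height Y = 1%N.
  have : (0 < #|X'| * height Y')%N by rewrite muln_gt0 X'_gt0.
  by rewrite eqh muln_gt0 => /andP[_ hY_gt0]; apply/eqP; rewrite eqn_leq hY.
have le_fg : f <= g.
  by rewrite phiM; apply/opmap_leP => x; rewrite !opconstE (le_trans (ltW ltcc')).
have lt_fg x : f x < g x.
  rewrite lt_neqAle (opmap_leP _ _ le_fg) andbT; apply/eqP => eq_fg.
  by have := rank_f x; rewrite eq_fg rank_g hY1.
have g_const x y : x <= y -> g x = g y.
  move/(opmap_homo g); rewrite le_eqVlt => /predU1P[//|/rank_lt].
  by rewrite !rank_g ltnn.
(* As [height Y] is 1, the interval from [f x] to [g x] has only its two ends. *)
have cover x b b' : f x <= b -> b < b' -> b' <= g x -> b = f x /\ b' = g x.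
  move=> lefb /rank_lt ltbb' leb'g.
  have b'1 : (rank b' <= 1)%N by rewrite -hY1 rank_height.
  split.
    move: lefb; rewrite le_eqVlt => /predU1P[//|/rank_lt ltfb].
    by have := leq_trans (leq_ltn_trans ltfb ltbb') b'1.
  move: leb'g; rewrite le_eqVlt => /predU1P[//|/rank_lt ltb'g].
  by have := leq_trans (leq_ltn_trans ltbb' ltb'g) (rank_height _); rewrite hY1.
pose J q := splice lec (@upset_ge _ X' q).
(* Irreducibility is phrased by the order alone, so [phi] carries [J q] and its lower cover to such
   a pair over [f] and [g]. *)
have /fin_all_exists[p pE] q : exists x, phi (J q) = splice le_fg (@upset_ge _ X x).
  have [lem ltm lej maxm] := atom_irreducible lec q ltcc' lec'e atom.
  pose m := splice lec (@upset_gt _ X' q).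
  apply: (irreducible_splice le_fg g_const cover lt_fg (m := phi m)).
  split.
  - by rewrite phiM; apply: lem.
  - by rewrite phi_lt; apply: ltm.
  - by rewrite phiM.
  - by move=> h; rewrite -[h]psiK !phiM phi_lt; apply: maxm.
(* Splicing reverses the order on both sides, and the two reversals cancel. *)
exists p => q r; rewrite -(splice_ge_mono le_fg lt_fg) -!pE phiM.
by rewrite splice_ge_mono // => x; rewrite !opconstE.
Qed.

(** * Antichains *)

(** At height 0 comparable elements are equal, so every function is order-preserving. *)
Lemma antichain_opmap_card dX (X : finPOrderType dX) :
  height X = 0%N -> #|{: opmap X X}| = (#|X| ^ #|X|)%N.
Proof.
move=> hX; rewrite -card_ffun; apply: (bij_eq_card (f := val)).
have homX (f : {ffun X -> X}) : {homo f : x y / x <= y}.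
  move=> x y; rewrite le_eqVlt => /predU1P[->//|/rank_lt lt_xy].
  by have := leq_trans lt_xy (rank_height y); rewrite hX.
exists (fun f => opmap_of (homX f)) => f; first by apply: opmapP => x; rewrite opmap_ofE.
by apply/ffunP => x; rewrite /= ffunE.
Qed.

Lemma antichain_isomorphic d d' (X : finPOrderType d) (Y : finPOrderType d') :
  height X = 0%N -> height Y = 0%N -> #|X| = #|Y| -> order_isomorphic X Y.
Proof.
have le_eq d0 (Z : finPOrderType d0) :
    height Z = 0%N -> forall x y : Z, (x <= y) = (x == y).
  move=> hZ x y; apply/idP/eqP => [|->//].
  rewrite le_eqVlt => /predU1P[//|/rank_lt lt_xy].
  by have := leq_trans lt_xy (rank_height y); rewrite hZ.
move=> hX hY eqXY; pose f x := enum_val (cast_ord eqXY (enum_rank x)) : Y.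
have f_bij : bijective f.
  exists (fun y => enum_val (cast_ord (esym eqXY) (enum_rank y))) => z.
    by rewrite /f enum_valK cast_ordK enum_rankK.
  by rewrite /f enum_valK cast_ordKV enum_rankK.
by exists f => // x y; rewrite !le_eq // (bij_eq f_bij).
Qed.

(** Serves to recover the size of an antichain from the number of its self-maps; positivity excludes
    the coincidence of [0 ^ 0] and [1 ^ 1]. *)
Lemma ltn_expn_self m n : (0 < m)%N -> (m < n)%N -> (m ^ m < n ^ n)%N.
Proof.
move=> m_gt0 ltmn; apply: (@leq_ltn_trans (n ^ m)); first by rewrite leq_exp2r // ltnW.
by rewrite ltn_exp2l // (leq_ltn_trans m_gt0).
Qed.

(** * Assembly of the antichain case and the case of positive height *)

Theorem theorem2p1 (dP dQ : Order.disp_t)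
    (P : finPOrderType dP) (Q : finPOrderType dQ)
    (P_nonempty : (0 < #|P|)%N) (Q_nonempty : (0 < #|Q|)%N)
    (hP : (height P <= 1)%N)
    (PP_iso_QQ : order_isomorphic (opmap P P) (opmap Q Q)) :
  order_isomorphic P Q.
Proof.
have QQ_iso_PP := order_isomorphic_sym PP_iso_QQ.
have eq_h : (#|Q| * height Q = #|P| * height P)%N.
  by apply/eqP; rewrite eqn_leq !iso_opmap_height_le.
have [hQ0|hQ_gt0] := posnP (height Q).
  have hP0 : height P = 0%N.
    apply/eqP; move/esym/eqP: eq_h; rewrite hQ0 muln0 muln_eq0.
    by rewrite -leqn0 leqNgt P_nonempty.
  apply: antichain_isomorphic => //.
  have [phi phi_bij _] := PP_iso_QQ.
  have := bij_eq_card phi_bij; rewrite !antichain_opmap_card //.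
  by case: (ltngtP #|P| #|Q|) => // /ltn_expn_self => [/(_ P_nonempty)|/(_ Q_nonempty)];
    rewrite ltn_neqAle => /andP[/eqP neq _] eq; case: neq.
have [e eM] := iso_opmap_embedding QQ_iso_PP Q_nonempty Q_nonempty hQ_gt0 hP eq_h.
have hQ1 : height Q = 1%N.
  by apply/eqP; rewrite eqn_leq hQ_gt0 (leq_trans (height_embedding eM)).
have hP1 : height P = 1%N.
  by apply/eqP; rewrite eqn_leq hP -hQ1 (height_embedding eM).
apply: order_isomorphic_sym; exists e => //.
(* With both heights equal to 1, [eq_h] says that the cardinalities agree, so the embedding is
   onto. *)
apply: inj_card_bij; first exact: inc_inj eM.
by move: eq_h; rewrite hP1 hQ1 !muln1 => ->.
Qed.
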